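(* For every graph $\Gamma$, $Gr(\Gamma)$ is a graded, unital, associative $*$-algebra and $\tau$ is a normalised trace on $Gr(\Gamma)$ (i.e. $\tau(1)=1$ and $\tau(xy)=\tau(yx)$ for all $x,y\in Gr(\Gamma)$).
   Context: Graphs. A graph $\Gamma$ means a finite, weighted, bipartite graph: a finite vertex set $V=V_0\sqcup V_1$, a finite set $E$ of oriented edges with start and finish maps $s,f:E\to V$ and a reversal involution $\xi\mapsto\tilde\xi$ of $E$ interchanging $s$ and $f$, such that $s(\xi)\in V_0\Leftrightarrow f(\xi)\in V_1$, and a weighting $\mu:V\to(0,\infty)$ with $\sum_{v\in V}\mu^2(v)=1$. A path $\xi$ of length $n\ge 0$ is $(v^\xi_0\xrightarrow{\xi_1}v^\xi_1\cdots\xrightarrow{\xi_n}v^\xi_n)$ with $\xi_i\in E$ an edge from $v^\xi_{i-1}$ to $v^\xi_i$; $s(\xi)=v_0^\xi$, $f(\xi)=v_n^\xi$; $\tilde\xi$ is the reversed path. $P_n(\Gamma)$ is the complex vector space with basis $\{[\xi]:\xi\text{ a path of length }n\}$. $Gr(\Gamma)=\bigoplus_{n\ge0}P_n(\Gamma)$ (graded by path length) with product $[\xi]\bullet[\eta]=[\xi\circ\eta]$ (concatenation) if $f(\xi)=s(\eta)$ and $0$ otherwise, extended bilinearly, and involution the conjugate-linear extension of $[\xi]^*=[\tilde\xi]$. The linear functional $\tau$ is given by $\tau([(v)])=\mu^2(v)$ on length zero paths and, for $\xi$ of length $n\ge1$, $\tau([\xi])=\sum_T\tau_T([\xi])$ over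 all Temperley–Lieb equivalence relations $T$ on $\{1,\dots,n\}$ (non-crossing partitions all of whose classes have exactly two elements; the sum is empty for $n$ odd), with $$\tau_T([\xi])=\prod_{\{i,j\}\in T,\,i<j}\delta_{\xi_i,\widetilde{\xi_j}}\prod_{C\in K(T)}\mu(v_C^\xi)^{2-|C|},$$ where $K(T)$ is the Kreweras complement of $T$ (the largest partition of $\{1',\dots,n'\}\cong\{1,\dots,n\}$ whose union with $T$ is non-crossing on $1<1'<2<2'<\cdots<n<n'$) and $v_C^\xi=v_c^\xi$ for any $c\in C$ (these coincide when the first product is non-zero). *)

(* Defs.v *)
From HB Require Import structures.
From mathcomp Require Import all_boot all_order all_algebra.
From mathcomp Require Import finmap.
From mathcomp Require Import reals.
From mathcomp Require Import complex.
From mathcomp Require Import monalg.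

Set Implicit Arguments.
Unset Strict Implicit.
Unset Printing Implicit Defensive.

Import Order.TTheory GRing.Theory Num.Theory.
Local Open Scope ring_scope.

Record is_graded_star_algebra (C : numClosedFieldType) (A : lmodType C)
    (P : nat -> {pred A}) (one : A) (mul : A -> A -> A) (star : A -> A)
    : Prop := IsGradedStarAlgebra {
  gsa_mul_linearl : forall y, linear (mul^~ y);
  gsa_mul_linearr : forall x, linear (mul x);
  gsa_mulA : associative mul;
  gsa_mul1l : left_id one mul;
  gsa_mul1r : right_id one mul;
  gsa_starD : forall x y, star (x + y) = star x + star y;
  gsa_starZ : forall (a : C) x, star (a *: x) = a^* *: star x;
  gsa_starK : involutive star;
  gsa_starM : forall x y, star (mul x y) = mul (star y) (star x);
  gsa_grade_submod : forall n, submod_closed (P n);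
  gsa_grade_span : forall x, exists (N : nat) (c : nat -> A),
    (forall n, c n \in P n) /\ x = \sum_(n < N) c n;
  gsa_grade_direct : forall (N : nat) (c : nat -> A),
    (forall n, c n \in P n) -> \sum_(n < N) c n = 0 ->
    forall n, (n < N)%N -> c n = 0;
  gsa_grade1 : one \in P 0%N;
  gsa_gradeM : forall m n x y,
    x \in P m -> y \in P n -> mul x y \in P (m + n)%N;
  gsa_grade_star : forall n x, x \in P n -> star x \in P n
}.

Record is_normalised_trace (C : numClosedFieldType) (A : lmodType C)
    (one : A) (mul : A -> A -> A) (tau : A -> C)
    : Prop := IsNormalisedTrace {
  nt_linear : scalar tau;
  nt_one : tau one = 1;
  nt_mulC : forall x y, tau (mul x y) = tau (mul y x)
}.

(* [V0] is one side of the bipartition; the other one is [~: V0]. *)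
Record graph (R : realType) := Graph {
  vertex : finType;
  edge : finType;
  V0 : {set vertex};
  esrc : edge -> vertex;
  etgt : edge -> vertex;
  erev : edge -> edge;
  mu : vertex -> R;
  erevK : involutive erev;
  esrc_rev : forall e, esrc (erev e) = etgt e;
  etgt_rev : forall e, etgt (erev e) = esrc e;
  bipartite : forall e, (esrc e \in V0) = (etgt e \in ~: V0);
  mu_gt0 : forall v, 0 < mu v;
  mu_sum1 : \sum_v mu v ^+ 2 = 1
}.

Section Paths.
Variables (R : realType) (G : graph R).

Fixpoint walk (v : vertex G) (s : seq (edge G)) : bool :=
  if s is e :: s' then (esrc e == v) && walk (etgt e) s' else true.

(* The vertices of a path other than the first one are determined by its
   edges; the initial vertex is recorded so that every vertex v gives a path
   (v) of length zero. *)
Record gpath := GPath {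
  gpath_val : vertex G * seq (edge G);
  gpath_walk : walk gpath_val.1 gpath_val.2
}.

HB.instance Definition _ := [isSub for gpath_val].
HB.instance Definition _ := [Choice of gpath by <:].

Definition pstart (p : gpath) : vertex G := (gpath_val p).1.
Definition pedges (p : gpath) : seq (edge G) := (gpath_val p).2.
Definition plength (p : gpath) : nat := size (pedges p).
Definition pend (p : gpath) : vertex G :=
  last (pstart p) (map (@etgt R G) (pedges p)).

Lemma walk_cat v s1 s2 :
  walk v (s1 ++ s2) = walk v s1 && walk (last v (map (@etgt R G) s1)) s2.
Proof. by elim: s1 v => //= e s1 IHs v; rewrite IHs andbA. Qed.

Lemma walk_rev v s :
  walk v s -> walk (last v (map (@etgt R G) s)) (rev (map (@erev R G) s)).
Proof.
elim: s v => //= e s IHs v /andP[_ ws]; have := IHs _ ws.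
rewrite rev_cons -cats1 walk_cat => ->; rewrite /= esrc_rev andbT.
case: s {IHs} ws => //= e' s /andP[/eqP <- _].
by rewrite rev_cons map_rcons last_rcons etgt_rev.
Qed.

Definition pnil (v : vertex G) : gpath := @GPath (v, [::]) isT.

Lemma path_cat_subproof (p q : gpath) (h : pend p = pstart q) :
  walk (pstart p) (pedges p ++ pedges q).
Proof.
by rewrite walk_cat -/(pend p) h; apply/andP; split; apply: gpath_walk.
Qed.

Definition path_cat (p q : gpath) (h : pend p = pstart q) : gpath :=
  @GPath (pstart p, pedges p ++ pedges q) (path_cat_subproof h).

Definition path_rev (p : gpath) : gpath :=
  @GPath (pend p, rev (map (@erev R G) (pedges p))) (walk_rev (gpath_walk p)).

End Paths.

Definition noncrossing (S : finType) (pos : S -> nat) (P : {set {set S}})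
    : bool :=
  [forall B1 in P, forall B2 in P,
   forall a in B1, forall b in B2, forall c in B1, forall d in B2,
     [&& pos a < pos b, pos b < pos c & pos c < pos d]%N ==> (B1 == B2)].

(* The index set {1, ..., n} is represented by 'I_n = {0, ..., n - 1}. *)
Definition TL (n : nat) : {set {set {set 'I_n}}} :=
  [set T | [&& partition T [set: 'I_n],
               noncrossing (@nat_of_ord n) T
             & [forall B in T, #|B| == 2%N]]].

(* In 'I_n + 'I_n, [inl i] is the point i and [inr i] is the point i', with
   the order 1 < 1' < 2 < 2' < ... < n < n'. *)
Definition interleave (n : nat) (x : 'I_n + 'I_n) : nat :=
  match x with inl i => i.*2 | inr i => i.*2.+1 end.

Definition kreweras_admissible (n : nat) (T K : {set {set 'I_n}}) : bool :=
  partition K [set: 'I_n] &&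
  noncrossing (@interleave n)
    ([set inl @: B | B : {set 'I_n} in T] :|:
     [set inr @: B | B : {set 'I_n} in K]).

Definition refines (S : finType) (Q K : {set {set S}}) : bool :=
  [forall C in Q, exists D in K, C \subset D].

Definition is_kreweras (n : nat) (T K : {set {set 'I_n}}) : bool :=
  kreweras_admissible T K &&
  [forall Q : {set {set 'I_n}}, kreweras_admissible T Q ==> refines Q K].

(* A largest admissible partition is unique, and it exists when T is a
   non-crossing partition; set0 is a dummy value. *)
Definition kreweras (n : nat) (T : {set {set 'I_n}}) : {set {set 'I_n}} :=
  odflt set0 [pick K | is_kreweras T K].

Section GradedAlgebra.
Variables (R : realType) (G : graph R).
Local Notation C := R[i].
Local Notation GrG := {malg C[gpath G]}.

(* The direct sum over n of the spaces P_n(G) is realised as the complex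
   vector space with basis all paths; [gr_grade n] is its subspace P_n(G). *)
Definition gr_grade (n : nat) : {pred GrG} :=
  [pred x : GrG | all (fun p => plength p == n) (msupp x)].

Definition gr_one : GrG := \sum_(v : vertex G) << pnil v >>.

Definition path_mul (p q : gpath G) : GrG :=
  if pend p =P pstart q is ReflectT h then << path_cat h >> else 0.

Definition gr_mul (x y : GrG) : GrG :=
  \sum_(p <- msupp x) \sum_(q <- msupp y) (x@_p * y@_q) *: path_mul p q.

Definition gr_star (x : GrG) : GrG :=
  \sum_(p <- msupp x) (x@_p)^* *: << path_rev p >>.

(* [c : 'I_n] stands for the index c + 1, so that v_C is the end point of the
   corresponding edge; a partition has no empty block, so the value 1 is
   never used. *)
Definition tau_block (n : nat) (xi : n.-tuple (edge G)) (B : {set 'I_n}) : R :=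
  if [pick c in B] is Some c then mu (etgt (tnth xi c)) ^ (2 - #|B|%:Z) else 1.

Definition tau_TL (n : nat) (xi : n.-tuple (edge G)) (T : {set {set 'I_n}})
    : R :=
  (\prod_(ij : 'I_n * 'I_n | (ij.1 < ij.2)%N && ([set ij.1; ij.2] \in T))
     (tnth xi ij.1 == erev (tnth xi ij.2))%:R)
  * \prod_(B in kreweras T) tau_block xi B.

Definition tau_path (p : gpath G) : R :=
  if plength p == 0%N then mu (pstart p) ^+ 2
  else \sum_(T in TL (plength p)) tau_TL (in_tuple (pedges p)) T.

Definition tau (x : GrG) : C := \sum_(p <- msupp x) x@_p * (tau_path p)%:C%C.

End GradedAlgebra.

(* Main.v *)
Require Import Defs.
From mathcomp Require Import all_boot all_order all_algebra reals complex monalg.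
From mathcomp Require Import finmap zify.

(* The algebra axioms hold on basis paths and extend by linearity.  For the
   trace, the delta factors of [tau_T] force the walk to be constant, up to
   cancelling excursions, on every T-stable interval of edges: the first edge
   of such an interval is the reverse of its partner, so the walk is back where
   it started after the partner.  Hence [tau] vanishes on open paths, and the
   vertex attached to a Kreweras block does not depend on the chosen point of
   the block.  Being non-crossing is a property of the cyclic order, so rotating
   a closed path permutes the Temperley-Lieb relations, compatibly with the
   Kreweras complement, and preserves the weights; this gives
   [tau (p * q) = tau (q * p)] on paths. *)

Set Implicit Arguments.
Unset Strict Implicit.
Unset Printing Implicit Defensive.

Import Order.TTheory GRing.Theory Num.Theory.
Local Open Scope ring_scope.

(** * Linear and bilinear extension from a basis *)

Section FreeModule.
Variables (C : comNzRingType) (K : choiceType).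
Local Notation M := {malg C[K]}.

(** Every element is a finite combination of basis elements. Applied to each argument in turn, this
    reduces every multilinear identity below to paths. *)
Lemma malg_linear_ind (P : M -> Prop) :
    P 0 -> (forall k, P << k >>) ->
    (forall c x y, P x -> P y -> P (c *: x + y)) -> forall x, P x.
Proof.
move=> P0 PU PD x; rewrite [x]monalgE.
elim: (enum_fset _) => [|k r IHr]; first by rewrite big_nil.
rewrite big_cons; have -> : << x@_k *g k >> = x@_k *: << k >> :> M.
  by apply/malgP => k'; rewrite mcoeffZ !mcoeffU mulr_natr.
exact: PD.
Qed.

Variables (s : {rmorphism C -> C}) (V : lmodType C).

(** The twist [s] lets one construction serve both the conjugate-linear star and, with [idfun], the
    linear maps. *)
Definition malg_lift (f : K -> V) (x : M) : V :=
  \sum_(k <- msupp x) s x@_k *: f k.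

(** Linearity compares sums over three different supports; a common finite index set puts them side
    by side. *)
Lemma malg_lift_widen f (D : {fset K}) x : (msupp x `<=` D)%fset ->
  malg_lift f x = \sum_(k <- D) s x@_k *: f k.
Proof.
move=> sxD; apply: big_fset_incl => // k _ kx.
by rewrite mcoeff_outdom // rmorph0 scale0r.
Qed.

Lemma malg_liftP f a x y :
  malg_lift f (a *: x + y) = s a *: malg_lift f x + malg_lift f y.
Proof.
pose D := (msupp x `|` msupp y)%fset.
rewrite !(@malg_lift_widen _ D) ?fsubsetUl ?fsubsetUr //; last first.
  by apply: fsubset_trans (msuppD_le _ _) _; rewrite fsetSU // msuppZ_le.
rewrite scaler_sumr -big_split /=; apply: eq_bigr => k _.
by rewrite mcoeffD mcoeffZ rmorphD rmorphM scalerDl scalerA.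
Qed.

Lemma malg_liftU f k : malg_lift f << k >> = f k.
Proof.
by rewrite /malg_lift msuppU oner_eq0 big_seq_fset1 mcoeffUU rmorph1 scale1r.
Qed.

Lemma malg_lift0 f : malg_lift f 0 = 0.
Proof. by rewrite /malg_lift msupp0 big_nil. Qed.

Lemma malg_lift_sum f (I : Type) (r : seq I) (F : I -> M) :
  malg_lift f (\sum_(i <- r) F i) = \sum_(i <- r) malg_lift f (F i).
Proof.
elim: r => [|i r IHr]; first by rewrite !big_nil malg_lift0.
by rewrite !big_cons -[F i]scale1r malg_liftP IHr rmorph1 !scale1r.
Qed.

Lemma malg_lift_funP a f g x :
  malg_lift (fun k => a *: f k + g k) x = a *: malg_lift f x + malg_lift g x.
Proof.
rewrite scaler_sumr -big_split /=; apply: eq_bigr => k _.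
by rewrite scalerDr !scalerA mulrC.
Qed.

Lemma malg_lift_fun0 x : malg_lift (fun=> 0) x = 0.
Proof. by apply: big1 => k _; rewrite scaler0. Qed.

End FreeModule.

Section MonomialProduct.
Variables (C : comNzRingType) (K : choiceType).
Local Notation M := {malg C[K]}.

Definition malg_mul (V : lmodType C) (m : K -> K -> V) (x y : M) : V :=
  \sum_(k <- msupp x) \sum_(l <- msupp y) (x@_k * y@_l) *: m k l.

Section Bilinear.
Variables (V : lmodType C) (m : K -> K -> V).
Local Notation "x ** y" := (malg_mul m x y) (at level 40).

(** As a nested lift, the product is linear in [x] by linearity of the outer lift and in [y] by that
    of the inner one. *)
Lemma malg_mulE x y :
  x ** y = malg_lift idfun (fun k => malg_lift idfun (m k) y) x.
Proof.
apply: eq_bigr => k _; rewrite /= scaler_sumr.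
by apply: eq_bigr => l _; rewrite scalerA.
Qed.

Lemma malg_mulPl y a x x' : (a *: x + x') ** y = a *: (x ** y) + x' ** y.
Proof. by rewrite !malg_mulE malg_liftP. Qed.

Lemma malg_mulPr y a x x' : y ** (a *: x + x') = a *: (y ** x) + y ** x'.
Proof.
rewrite !malg_mulE -malg_lift_funP; apply: eq_bigr => k _.
by rewrite malg_liftP.
Qed.

Lemma malg_mul0l x : 0 ** x = 0.
Proof. by rewrite malg_mulE malg_lift0. Qed.

Lemma malg_mul0r x : x ** 0 = 0.
Proof.
rewrite malg_mulE -[RHS](malg_lift_fun0 idfun _ x); apply: eq_bigr => k _.
by rewrite malg_lift0.
Qed.

Lemma malg_mulUU k l : << k >> ** << l >> = m k l.
Proof. by rewrite malg_mulE !malg_liftU. Qed.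

Lemma malg_mul_suml (I : Type) (s : seq I) (F : I -> M) y :
  (\sum_(i <- s) F i) ** y = \sum_(i <- s) F i ** y.
Proof.
elim: s => [|i s IHs]; first by rewrite !big_nil malg_mul0l.
by rewrite !big_cons -[F i]scale1r malg_mulPl IHs !scale1r.
Qed.

Lemma malg_mul_sumr (I : Type) (s : seq I) (F : I -> M) y :
  y ** (\sum_(i <- s) F i) = \sum_(i <- s) y ** F i.
Proof.
elim: s => [|i s IHs]; first by rewrite !big_nil malg_mul0r.
by rewrite !big_cons -[F i]scale1r malg_mulPr IHs !scale1r.
Qed.

End Bilinear.

Variable m : K -> K -> M.
Local Notation "x ** y" := (malg_mul m x y) (at level 40).

(** The values of [m] are vectors rather than basis elements because two paths may have product
    zero. *)
Lemma malg_mulA :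
    (forall k l h, << k >> ** m l h = m k l ** << h >>) ->
  associative (malg_mul m).
Proof.
move=> mA x y z; elim/malg_linear_ind: x => [|k|a x x' IH IH'].
- by rewrite !malg_mul0l.
- elim/malg_linear_ind: y => [|l|a y y' IH IH'].
  + by rewrite malg_mul0r !malg_mul0l malg_mul0r.
  + elim/malg_linear_ind: z => [|h|a z z' IH IH'].
    * by rewrite !malg_mul0r.
    * by rewrite !malg_mulUU mA.
    * by rewrite !malg_mulPr IH IH'.
  + by rewrite !(malg_mulPl, malg_mulPr) IH IH'.
- by rewrite !malg_mulPl IH IH'.
Qed.

Lemma malg_mul1l e : (forall k, e ** << k >> = << k >>) ->
  left_id e (malg_mul m).
Proof.
move=> e1 x; elim/malg_linear_ind: x => [|k|a x y IH IH'] //.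
  by rewrite malg_mul0r.
by rewrite malg_mulPr IH IH'.
Qed.

Lemma malg_mul1r e : (forall k, << k >> ** e = << k >>) ->
  right_id e (malg_mul m).
Proof.
move=> e1 x; elim/malg_linear_ind: x => [|k|a x y IH IH'] //.
  by rewrite malg_mul0l.
by rewrite malg_mulPl IH IH'.
Qed.

Section Star.
Variables (s : {rmorphism C -> C}) (f : K -> K).
Let star : M -> M := malg_lift s (fun k => << f k >>).

Lemma malg_starK : involutive s -> involutive f -> involutive star.
Proof.
move=> sK fK x; rewrite /star; elim/malg_linear_ind: x => [|k|a x y IH IH'].
- by rewrite !malg_lift0.
- by rewrite !malg_liftU fK.
- by rewrite !malg_liftP IH IH' sK.
Qed.

Lemma malg_starM : (forall k l, star (m k l) = m (f l) (f k)) ->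
  forall x y, star (x ** y) = star y ** star x.
Proof.
rewrite /star => fM x y; elim/malg_linear_ind: x => [|k|a x x' IH IH'].
- by rewrite malg_mul0l malg_lift0 malg_mul0r.
- elim/malg_linear_ind: y => [|l|a y y' IH IH'].
  + by rewrite malg_mul0r malg_lift0 malg_mul0l.
  + by rewrite malg_mulUU !malg_liftU malg_mulUU fM.
  + by rewrite malg_mulPr !malg_liftP malg_mulPl IH IH'.
- by rewrite malg_mulPl !malg_liftP malg_mulPr IH IH'.
Qed.

End Star.

Lemma malg_lift_mulC (s : {rmorphism C -> C}) (V : lmodType C) (t : K -> V) :
    (forall k l, malg_lift s t (m k l) = malg_lift s t (m l k)) ->
  forall x y, malg_lift s t (x ** y) = malg_lift s t (y ** x).
Proof.
move=> tC x y; elim/malg_linear_ind: x => [|k|a x x' IH IH'].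
- by rewrite malg_mul0l malg_mul0r.
- elim/malg_linear_ind: y => [|l|a y y' IH IH'].
  + by rewrite malg_mul0l malg_mul0r.
  + by rewrite !malg_mulUU.
  + by rewrite malg_mulPr malg_mulPl !malg_liftP IH IH'.
- by rewrite malg_mulPr malg_mulPl !malg_liftP IH IH'.
Qed.

End MonomialProduct.

(** * The path algebra *)

Section PathAlgebra.
Variables (R : realType) (G : graph R).
Local Notation C := R[i].
Local Notation GrG := {malg C[gpath G]}.
Implicit Types (p q r : gpath G) (x y z : GrG).

Lemma gpathP p q : pstart p = pstart q -> pedges p = pedges q -> p = q.
Proof.
case: p q => [[v s] ws] [[w t] wt]; rewrite /pstart /pedges /= => e1 e2.
by apply: val_inj; rewrite /= e1 e2.
Qed.

Lemma pend_cat p q (h : pend p = pstart q) : pend (path_cat h) = pend q.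
Proof. by rewrite {1}/pend /= map_cat last_cat -/(pend p) h. Qed.

Lemma pend_rev p : pend (path_rev p) = pstart p.
Proof.
rewrite /pend /path_rev /pstart /pedges /=.
case: p => [[v [|e s]]] //= w; have /andP[/eqP ve _] := w.
by rewrite rev_cons map_rcons last_rcons etgt_rev.
Qed.

(** The proof [h] enters [path_cat] only through the walk certificate, so any two choices give the
    same path. *)
Lemma path_mul_cat p q (h : pend p = pstart q) :
  path_mul p q = << path_cat h >>.
Proof.
rewrite /path_mul; case: (pend p =P pstart q) => [h'|/(_ h)//].
by congr << _ >>; apply: gpathP.
Qed.

Lemma path_mul_neq p q : pend p != pstart q -> path_mul p q = 0.
Proof. by rewrite /path_mul; case: (pend p =P pstart q). Qed.

Lemma gr_mulE : @gr_mul R G = malg_mul (@path_mul R G).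
Proof. by []. Qed.

(** Concatenation keeps the outer endpoints, so both sides vanish as soon as one of the two
    junctions fails to match. *)
Lemma path_mulA p q r :
  gr_mul << p >> (path_mul q r) = gr_mul (path_mul p q) << r >>.
Proof.
rewrite gr_mulE; have [hqr|nqr] := eqVneq (pend q) (pstart r); last first.
  rewrite (path_mul_neq nqr) malg_mul0r.
  have [hpq|npq] := eqVneq (pend p) (pstart q); last first.
    by rewrite (path_mul_neq npq) malg_mul0l.
  by rewrite (path_mul_cat hpq) malg_mulUU path_mul_neq // pend_cat.
rewrite (path_mul_cat hqr) malg_mulUU.
have [hpq|npq] := eqVneq (pend p) (pstart q); last first.
  by rewrite (path_mul_neq npq) path_mul_neq // malg_mul0l.
have hpqr : pend p = pstart (path_cat hqr) by [].
have hpqr' : pend (path_cat hpq) = pstart r by rewrite pend_cat.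
rewrite (path_mul_cat hpqr) (path_mul_cat hpq) malg_mulUU (path_mul_cat hpqr').
by congr << _ >>; apply: gpathP => //; rewrite /pedges /= catA.
Qed.

Lemma gr_mulA : associative (@gr_mul R G).
Proof. exact/malg_mulA/path_mulA. Qed.

Lemma gr_mul1l : left_id (gr_one G) (@gr_mul R G).
Proof.
(* Of the vertex idempotents only the one at the start of [p] survives. *)
apply: malg_mul1l => p; rewrite malg_mul_suml (bigD1 (pstart p)) //=.
rewrite big1 => [|v nv]; last by rewrite malg_mulUU path_mul_neq.
have h : pend (pnil (pstart p)) = pstart p by [].
rewrite addr0 malg_mulUU (path_mul_cat h).
by congr << _ >>; apply: gpathP.
Qed.

Lemma gr_mul1r : right_id (gr_one G) (@gr_mul R G).
Proof.
apply: malg_mul1r => p; rewrite malg_mul_sumr (bigD1 (pend p)) //=.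
rewrite big1 => [|v nv]; last by rewrite malg_mulUU path_mul_neq // eq_sym.
have h : pend p = pstart (pnil (pend p)) by [].
rewrite addr0 malg_mulUU (path_mul_cat h).
by congr << _ >>; apply: gpathP => //; rewrite /pedges /= cats0.
Qed.

Lemma gr_starE x :
  gr_star x = malg_lift (Num.conj : {rmorphism C -> C})
                        (fun p => << path_rev p >> : GrG) x.
Proof. by []. Qed.

Lemma gr_starP a x y : gr_star (a *: x + y) = a^* *: gr_star x + gr_star y.
Proof. by rewrite !gr_starE malg_liftP. Qed.

Lemma gr_star0 : gr_star 0 = 0 :> GrG.
Proof. by rewrite gr_starE malg_lift0. Qed.

Lemma gr_starU p : gr_star << p >> = << path_rev p >> :> GrG.
Proof. by rewrite gr_starE malg_liftU. Qed.

Lemma path_revK : involutive (@path_rev R G).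
Proof.
move=> p; apply: gpathP; first exact: pend_rev.
rewrite /path_rev /pedges /= map_rev revK mapK //; exact: erevK.
Qed.

Lemma gr_starK : involutive (@gr_star R G).
Proof. exact: (malg_starK (@conjCK C) path_revK). Qed.

Lemma gr_star_path_mul p q :
  gr_star (path_mul p q) = path_mul (path_rev q) (path_rev p).
Proof.
have [h|n] := eqVneq (pend p) (pstart q); last first.
  by rewrite !path_mul_neq ?gr_star0 // pend_rev eq_sym.
have h' : pend (path_rev q) = pstart (path_rev p) by rewrite pend_rev.
rewrite (path_mul_cat h) (path_mul_cat h') gr_starU; congr << _ >>.
apply: gpathP; first exact: pend_cat.
by rewrite /pedges /= map_cat rev_cat.
Qed.

Lemma gr_starM x y : gr_star (gr_mul x y) = gr_mul (gr_star y) (gr_star x).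
Proof. exact: (malg_starM gr_star_path_mul). Qed.

Lemma gr_gradeP n x :
  reflect (forall p, plength p != n -> x@_p = 0) (x \in @gr_grade R G n).
Proof.
apply: (iffP allP) => [xn p|xn p].
  by apply: contraNeq; rewrite mcoeff_neq0; apply: xn.
by rewrite -mcoeff_neq0; apply: contraR => /xn ->.
Qed.

Lemma gr_gradeU n p : plength p = n -> << p >> \in @gr_grade R G n.
Proof.
move=> pn; apply/allP => q; rewrite msuppU oner_eq0 inE => /eqP ->.
by rewrite pn.
Qed.

Lemma gr_grade_submod n : submod_closed (@gr_grade R G n).
Proof.
split=> [|a x y /gr_gradeP xn /gr_gradeP yn]; apply/gr_gradeP => p pn.
  by rewrite mcoeff0.
by rewrite mcoeffD mcoeffZ xn ?yn // mulr0 addr0.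
Qed.

Lemma gr_grade_sum n (I : eqType) (r : seq I) (F : I -> GrG) :
  (forall i, i \in r -> F i \in @gr_grade R G n) ->
  \sum_(i <- r) F i \in @gr_grade R G n.
Proof.
move=> Fn; rewrite big_seq; elim/big_rec: _ => [|i x ir xn].
  by case: (gr_grade_submod n).
by rewrite -[F i]scale1r; apply: (gr_grade_submod n).2; rewrite ?Fn.
Qed.

Lemma gr_gradeZ n a x : x \in @gr_grade R G n -> a *: x \in @gr_grade R G n.
Proof.
by move=> xn; rewrite -[_ *: _]addr0; apply: (gr_grade_submod n).2 => //;
  case: (gr_grade_submod n).
Qed.

Lemma plength_supp n x p :
  x \in @gr_grade R G n -> p \in msupp x -> plength p = n.
Proof. by move=> /allP xn /xn /eqP. Qed.

Lemma gr_gradeM m n x y : x \in @gr_grade R G m -> y \in @gr_grade R G n ->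
  gr_mul x y \in @gr_grade R G (m + n).
Proof.
move=> xm yn; apply: gr_grade_sum => p /(plength_supp xm) pm.
apply: gr_grade_sum => q /(plength_supp yn) qn; apply: gr_gradeZ.
have [h|npq] := eqVneq (pend p) (pstart q).
  by rewrite (path_mul_cat h) gr_gradeU // /plength size_cat -pm -qn.
by rewrite path_mul_neq //; case: (gr_grade_submod (m + n)).
Qed.

Lemma gr_grade_star n x : x \in @gr_grade R G n -> gr_star x \in @gr_grade R G n.
Proof.
move=> xn; apply: gr_grade_sum => p /(plength_supp xn) pn.
by apply/gr_gradeZ/gr_gradeU; rewrite /plength size_rev size_map.
Qed.

Lemma gr_grade1 : gr_one G \in @gr_grade R G 0.
Proof. by apply: gr_grade_sum => v _; apply: gr_gradeU. Qed.

Lemma gr_grade_span x : exists (N : nat) (c : nat -> GrG),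
  (forall n, c n \in @gr_grade R G n) /\ x = \sum_(n < N) c n.
Proof.
(* One more than the longest length in the support, so that every path of the support is counted in
   some degree below [N]. *)
pose N := (\max_(p <- msupp x) plength p).+1.
exists N, (fun n => \sum_(p <- msupp x | plength p == n) << x@_p *g p >>).
split=> [n|].
  rewrite -big_filter; apply: gr_grade_sum => p.
  rewrite mem_filter => /andP[/eqP pn _].
  apply/gr_gradeP => q; rewrite mcoeffU.
  by case: (eqVneq p q) => [<-|//]; rewrite pn eqxx.
rewrite [LHS]monalgE (exchange_big_dep predT) //=.
rewrite big_seq [RHS]big_seq; apply: eq_bigr => p px.
have pN : (plength p < N)%N by rewrite ltnS; apply: leq_bigmax_seq.
rewrite (bigD1 (Ordinal pN)) //= big1 ?addr0 // => i /andP[/eqP pi].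
by case/eqP; apply: val_inj.
Qed.

Lemma gr_grade_direct N (c : nat -> GrG) :
  (forall n, c n \in @gr_grade R G n) -> \sum_(n < N) c n = 0 ->
  forall n, (n < N)%N -> c n = 0.
Proof.
move=> cn sum0 n nN; apply/malgP => p; rewrite mcoeff0.
have [pn|] := eqVneq (plength p) n; last by have /gr_gradeP := cn n; apply.
have := congr1 (mcoeff p) sum0.
rewrite raddf_sum mcoeff0 (bigD1 (Ordinal nN)) //= big1 ?addr0 // => i ni.
have /gr_gradeP -> // := cn i; rewrite pn.
by apply: contraNneq ni => ni; apply/eqP/val_inj; rewrite /= ni.
Qed.

Lemma gr_graded_star_algebra : is_graded_star_algebra
  (@gr_grade R G) (gr_one G) (@gr_mul R G) (@gr_star R G).
Proof.
split.
- by move=> y a x x'; apply: malg_mulPl.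
- by move=> x a y y'; apply: malg_mulPr.
- exact: gr_mulA.
- exact: gr_mul1l.
- exact: gr_mul1r.
- by move=> x y; rewrite -[x]scale1r gr_starP conjC1 !scale1r.
- by move=> a x; rewrite -[a *: x]addr0 gr_starP gr_star0 addr0.
- exact: gr_starK.
- exact: gr_starM.
- exact: gr_grade_submod.
- exact: gr_grade_span.
- exact: gr_grade_direct.
- exact: gr_grade1.
- exact: gr_gradeM.
- exact: gr_grade_star.
Qed.

End PathAlgebra.

(** * Rotation of non-crossing partitions *)

Lemma noncrossingP (S : finType) (pos : S -> nat) (P : {set {set S}}) :
  reflect (forall B1 B2 a b c d, B1 \in P -> B2 \in P ->
             a \in B1 -> b \in B2 -> c \in B1 -> d \in B2 ->
             (pos a < pos b < pos c)%N -> (pos c < pos d)%N -> B1 = B2)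
          (noncrossing pos P).
Proof.
apply: (iffP idP) => [ncP B1 B2 a b c d B1P B2P aB bB cB dB /andP[ab bc] cd|ncP].
  move: ncP => /forall_inP/(_ _ B1P)/forall_inP/(_ _ B2P)/forall_inP/(_ _ aB).
  move=> /forall_inP/(_ _ bB)/forall_inP/(_ _ cB)/forall_inP/(_ _ dB).
  by rewrite ab bc cd => /eqP.
apply/forall_inP => B1 B1P; apply/forall_inP => B2 B2P.
apply/forall_inP => a aB; apply/forall_inP => b bB.
apply/forall_inP => c cB; apply/forall_inP => d dB.
apply/implyP => /and3P[ab bc cd]; apply/eqP.
by apply: (ncP _ _ a b c d) => //; rewrite ab.
Qed.

(* Four points alternating between two blocks still alternate after any
   cyclic shift of the positions. *)
Lemma noncrossing_cyclic (S : finType) (pos : S -> nat) (f : S -> S)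
    (N k : nat) (P : {set {set S}}) :
    (k <= N)%N -> (forall x, pos x < N)%N ->
    (forall x, pos (f x) = (pos x + k) %% N)%N ->
  noncrossing pos P -> noncrossing pos [set f @: B | B : {set S} in P].
Proof.
move=> kN posN posf /noncrossingP ncP; apply/noncrossingP.
move=> ? ? ? ? ? ? /imsetP[B1 B1P ->] /imsetP[B2 B2P ->].
move=> /imsetP[a aB ->] /imsetP[b bB ->] /imsetP[c cB ->] /imsetP[d dB ->].
(* Since [pos x < N] and [k <= N], the shift wraps around at most once. *)
have posE x : pos (f x) = (if pos x + k < N then pos x + k else pos x + k - N)%N.
  rewrite posf; case: ltnP => h; first by rewrite modn_small.
  by rewrite -{1}(subnK h) modnDr modn_small //; have := posN x; lia.
(* If the shifted points are in increasing order, the original ones are in increasing order up to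
   one of four cyclic rotations. *)
have cyc na nb nc nd : (na < N -> nb < N -> nc < N -> nd < N ->
    let sh x := if x + k < N then x + k else x + k - N in
    sh na < sh nb < sh nc -> sh nc < sh nd ->
    [|| (na < nb < nc) && (nc < nd), (nb < nc < nd) && (nd < na),
        (nc < nd < na) && (na < nb) | (nd < na < nb) && (nb < nc)])%N.
  move=> aN bN cN dN /=; move: kN aN bN cN dN; clear.
  case: (ltnP (na + k) N) => ?; case: (ltnP (nb + k) N) => ?;
  by case: (ltnP (nc + k) N) => ?; case: (ltnP (nd + k) N) => ?; lia.
rewrite !posE => ab cd; suff -> : B1 = B2 :> {set S} by [].
(* Starting from [b] or [d] exchanges the roles of the two blocks, hence the symmetry of equality in
   those cases. *)
case/or4P: (cyc _ _ _ _ (posN a) (posN b) (posN c) (posN d) ab cd).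
- by case/andP; apply: (ncP _ _ a b c d).
- by case/andP => h1 h2; apply/esym; apply: (ncP _ _ b c d a).
- by case/andP; apply: (ncP _ _ c d a b).
- by case/andP => h1 h2; apply/esym; apply: (ncP _ _ d a b c).
Qed.

Lemma imset_comp_id (S : finType) (f g : S -> S) (B : {set S}) :
  cancel f g -> g @: (f @: B) = B.
Proof. by move=> fK; rewrite -imset_comp (eq_imset _ fK) imset_id. Qed.

(** The codomain may differ so as to cover [inl] and [inr] along with rotations. *)
Definition img_family (S S' : finType) (f : S -> S') (P : {set {set S}}) :
  {set {set S'}} := [set f @: B | B : {set S} in P].

Lemma img_familyK (S : finType) (f g : S -> S) :
  cancel f g -> cancel (img_family f) (img_family g).
Proof.
move=> fK P; rewrite /img_family -imset_comp -[RHS]imset_id.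
by apply: eq_imset => B /=; apply: imset_comp_id.
Qed.

Lemma img_family_partition (S : finType) (f g : S -> S) (P : {set {set S}}) :
  cancel f g -> cancel g f ->
  partition P [set: S] -> partition (img_family f P) [set: S].
Proof.
move=> fK gK /and3P[/eqP covP /trivIsetP tiP P0]; apply/and3P; split.
- apply/eqP/setP => x; rewrite inE; apply/bigcupP.
  have : g x \in cover P by rewrite covP inE.
  case/bigcupP => B BP gxB; exists (f @: B); first exact: imset_f.
  by rewrite -[x]gK imset_f.
- apply/trivIsetP => _ _ /imsetP[B BP ->] /imsetP[D DP ->] nBD.
  have {}nBD : B != D by apply: contraNneq nBD => ->.
  have := tiP _ _ BP DP nBD; rewrite -!setI_eq0 => /eqP BD0.
  by rewrite -imsetI ?BD0 ?imset0 // => x y _ _; apply: (can_inj fK).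
- apply: contra P0 => /imsetP[B BP /esym/eqP]; rewrite imset_eq0 => /eqP B0.
  by rewrite -B0.
Qed.

Lemma img_family_refines (S : finType) (f : S -> S) (P Q : {set {set S}}) :
  refines P Q -> refines (img_family f P) (img_family f Q).
Proof.
move=> /forall_inP PQ; apply/forall_inP => _ /imsetP[B BP ->].
have /exists_inP[D DQ BD] := PQ _ BP.
by apply/exists_inP; exists (f @: D); [apply: imset_f | apply: imsetS].
Qed.

(** A block of [P] lies in a block of [Q], which lies in a block of [P]; the two blocks of [P] meet,
    so all three coincide. This gives uniqueness of the Kreweras complement. *)
Lemma refines_subset (S : finType) (D : {set S}) (P Q : {set {set S}}) :
  partition P D -> refines P Q -> refines Q P -> P \subset Q.
Proof.
move=> /and3P[_ tiP P0] /forall_inP PQ /forall_inP QP.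
apply/subsetP => B BP; have /exists_inP[E EQ BE] := PQ _ BP.
have /exists_inP[F FP EF] := QP _ EQ.
have /set0Pn[x xB] : B != set0 by apply: contraNneq P0 => <-.
have xF : x \in F by apply: (subsetP EF); apply: (subsetP BE).
have BF : B = F by rewrite -(def_pblock tiP BP xB) (def_pblock tiP FP xF).
suff -> : B = E by [].
by apply/eqP; rewrite eqEsubset BE BF EF.
Qed.

(** * Rotation of Temperley-Lieb relations and Kreweras complements *)

Section RotateTL.
Variable n : nat.
Implicit Types (T K Q : {set {set 'I_n}}).

Lemma ord_rot_subproof (j : nat) (i : 'I_n) : ((i + j) %% n < n)%N.
Proof. by rewrite ltn_mod; case: n i => // -[]. Qed.

Definition ord_rot (j : nat) (i : 'I_n) : 'I_n := Ordinal (ord_rot_subproof j i).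

Lemma ord_rotK j : (j <= n)%N -> cancel (ord_rot j) (ord_rot (n - j)).
Proof.
move=> jn i; apply: val_inj; rewrite /= modnDml -addnA subnKC // modnDr.
by rewrite modn_small.
Qed.

Lemma ord_rotVK j : (j <= n)%N -> cancel (ord_rot (n - j)) (ord_rot j).
Proof.
by move=> jn i; rewrite -[in ord_rot j](subKn jn) ord_rotK // leq_subr.
Qed.

Local Notation rotf j := (img_family (ord_rot j)).

Lemma TL_rot j T : (j <= n)%N -> T \in TL n -> rotf j T \in TL n.
Proof.
move=> jn; rewrite !inE => /and3P[pT ncT /forall_inP cT]; apply/and3P; split.
- by apply: img_family_partition pT; [apply: ord_rotK | apply: ord_rotVK].
- by apply: (noncrossing_cyclic jn _ _ ncT) => // x; apply: ltn_ord.
- apply/forall_inP => _ /imsetP[B BT ->].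
  by rewrite card_imset ?cT //; apply: can_inj (ord_rotK jn).
Qed.

(** Rotating both copies of the n points by [j] is rotating the 2n interleaved points by 2j, so
    [noncrossing_cyclic] applies to the union. *)
Lemma kreweras_admissible_rot j T K : (j <= n)%N ->
  kreweras_admissible T K -> kreweras_admissible (rotf j T) (rotf j K).
Proof.
move=> jn /andP[pK ncTK]; apply/andP; split.
  by apply: img_family_partition pK; [apply: ord_rotK | apply: ord_rotVK].
pose f (x : 'I_n + 'I_n) : 'I_n + 'I_n :=
  match x with inl i => inl (ord_rot j i) | inr i => inr (ord_rot j i) end.
have fl (P : {set {set 'I_n}}) :
    img_family inl (rotf j P) = img_family f (img_family inl P).
  rewrite /img_family -!imset_comp; apply: eq_imset => B /=.
  by rewrite -!imset_comp; apply: eq_imset.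
have fr (P : {set {set 'I_n}}) :
    img_family inr (rotf j P) = img_family f (img_family inr P).
  rewrite /img_family -!imset_comp; apply: eq_imset => B /=.
  by rewrite -!imset_comp; apply: eq_imset.
rewrite -/(img_family inl _) -/(img_family inr _) fl fr -imsetU.
have j2n : (j.*2 <= n.*2)%N by rewrite leq_double.
apply: noncrossing_cyclic j2n _ _ ncTK => -[] i /=.
- by have := ltn_ord i; lia.
- by have := ltn_ord i; lia.
- by rewrite -!muln2 -mulnDl muln_modl.
(* For a primed point the position is odd: with r the residue of i + j modulo n, 2r + 1 is still
   below 2n and is thus the residue modulo 2n. *)
have n_gt0 : (0 < n)%N by have := ltn_ord i; lia.
have := ltn_pmod (i + j) n_gt0; have := divn_eq (i + j) n.
set r := ((i + j) %% n)%N; set q := ((i + j) %/ n)%N => ijE rn.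
have -> : (i.*2.+1 + j.*2 = q * n.*2 + r.*2.+1)%N.
  by rewrite -!muln2 mulnA; lia.
by rewrite modnMDl modn_small //; lia.
Qed.

(** For maximality, a competitor [Q] is rotated back by [n - j], compared with [K], and the
    comparison rotated forward. *)
Lemma is_kreweras_rot j T K : (j <= n)%N ->
  is_kreweras T K -> is_kreweras (rotf j T) (rotf j K).
Proof.
move=> jn /andP[adm /forallP maxK]; apply/andP; split.
  exact: kreweras_admissible_rot.
apply/forallP => Q; apply/implyP => admQ.
have := kreweras_admissible_rot (leq_subr j n) admQ.
rewrite (img_familyK (ord_rotK jn)) => /(implyP (maxK _)).
by move/(img_family_refines (ord_rot j)); rewrite (img_familyK (ord_rotVK jn)).
Qed.

Lemma is_kreweras_uniq T K Q : is_kreweras T K -> is_kreweras T Q -> K = Q.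
Proof.
move=> /andP[admK /forallP maxK] /andP[admQ /forallP maxQ].
have KQ := implyP (maxQ K) admK; have QK := implyP (maxK Q) admQ.
have [[pK _] [pQ _]] := (andP admK, andP admQ).
by apply/eqP; rewrite eqEsubset !(refines_subset (D := setT)).
Qed.

(** The dummy value is kept as a second case, and later arguments treat both. *)
Lemma krewerasP T : is_kreweras T (kreweras T) \/
  kreweras T = set0 /\ forall K, ~~ is_kreweras T K.
Proof.
rewrite /kreweras; case: pickP => [K TK|noK]; first by left.
by right; split=> // K; rewrite noK.
Qed.

Lemma kreweras_rot j T : (j <= n)%N -> kreweras (rotf j T) = rotf j (kreweras T).
Proof.
move=> jn; have [KT|[-> noK]] := krewerasP T.
  have KrT := is_kreweras_rot jn KT.
  have [KT'|[_ /(_ (rotf j (kreweras T)))]] := krewerasP (rotf j T).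
    exact: is_kreweras_uniq KT' KrT.
  by rewrite KrT.
(* A complement of the rotated relation would rotate back to one of [T], which has none. *)
have [KrT|[-> _]] := krewerasP (rotf j T); last by rewrite /img_family imset0.
have := is_kreweras_rot (leq_subr j n) KrT.
by rewrite (img_familyK (ord_rotK jn)) (negPf (noK _)).
Qed.

End RotateTL.

(** * Weights of paths *)

Section TLBlocks.
Variables (n : nat) (T : {set {set 'I_n}}) (TLT : T \in TL n).

Lemma TL_partner i : exists2 j, j != i & [set i; j] \in T.
Proof.
move: TLT; rewrite inE => /and3P[/and3P[/eqP covT _ _] _ /forall_inP cT].
have : i \in cover T by rewrite covT inE.
case/bigcupP => B BT iB; have /cards1P[j Bj] : #|B :\ i| == 1%N.
  by have := cT _ BT; rewrite (cardsD1 i B) iB.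
exists j; last by rewrite -Bj setD1K.
by have := set11 j; rewrite -Bj in_setD1 => /andP[].
Qed.

Lemma TL_partner_uniq i j h : j != i -> h != i ->
  [set i; j] \in T -> [set i; h] \in T -> j = h.
Proof.
move=> ji hi ijT ihT.
move: TLT; rewrite inE => /and3P[/and3P[_ tiT _] _ _].
have e : [set i; j] = [set i; h].
  by rewrite -(def_pblock tiT ijT (set21 _ _)) (def_pblock tiT ihT (set21 _ _)).
by have := set22 i j; rewrite e !inE (negPf ji) => /eqP.
Qed.

Lemma TL_noncrossing a b c d : [set a; c] \in T -> [set b; d] \in T ->
  (a < b < c)%N -> (c < d)%N -> False.
Proof.
move=> acT bdT abc cd; move: TLT; rewrite inE => /and3P[_ /noncrossingP ncT _].
have := ncT _ _ a b c d acT bdT; rewrite !inE !eqxx !orbT.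
move=> /(_ isT isT isT isT abc cd)/setP/(_ d).
by rewrite !inE eqxx orbT !(eq_sym d);
  rewrite -!val_eqE /=; case: eqP => [|_]; case: eqP; lia.
Qed.

End TLBlocks.

(** * Delta factors and the vertices visited by a walk *)

Section Delta.
Variables (R : realType) (G : graph R).

Lemma walk_nth v (s : seq (edge G)) (e0 : edge G) i :
  walk v s -> (i < size s)%N ->
  esrc (nth e0 s i) = last v (map (@etgt R G) (take i s)) /\
  etgt (nth e0 s i) = last v (map (@etgt R G) (take i.+1 s)).
Proof.
elim: s v i => [|e s IHs] v [|i] //= /andP[/eqP ve ws] iS.
  by rewrite take0.
exact: IHs.
Qed.

Variables (n : nat) (xi : n.-tuple (edge G)).

(** All ordered pairs are quantified over, not only i < j: a rotation may reverse the order within a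
    pair. Since [erev] is an involution, the condition is symmetric. *)
Definition delta_TL (T : {set {set 'I_n}}) : bool :=
  [forall i : 'I_n, forall j : 'I_n, (i != j) && ([set i; j] \in T) ==>
    (tnth xi i == erev (tnth xi j))].

Lemma delta_TLP (T : {set {set 'I_n}}) : reflect
  (forall i j, i != j -> [set i; j] \in T -> tnth xi i = erev (tnth xi j))
  (delta_TL T).
Proof.
apply: (iffP idP) => [/forallP dT i j ij ijT|dT].
  by have /forallP/(_ j) := dT i; rewrite ij ijT => /eqP.
apply/forallP => i; apply/forallP => j; apply/implyP => /andP[ij ijT].
exact/eqP/dT.
Qed.

Lemma tau_TLE (T : {set {set 'I_n}}) : tau_TL xi T =
  (delta_TL T)%:R * \prod_(B in kreweras T) tau_block xi B.
Proof.
congr (_ * _); have [/delta_TLP dT|ndT] := boolP (delta_TL T).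
  apply: big1 => ij /andP[ltij ijT]; rewrite (dT _ _ _ ijT) ?eqxx //.
  by rewrite -val_eqE neq_ltn ltij.
suff [ij ijP nij] : exists2 ij : 'I_n * 'I_n,
    (ij.1 < ij.2)%N && ([set ij.1; ij.2] \in T)
    & tnth xi ij.1 != erev (tnth xi ij.2).
  by rewrite (bigD1 ij ijP) /= (negPf nij) mul0r.
case/forallPn: ndT => i /forallPn[j].
rewrite negb_imply => /andP[/andP[ij ijT] nij].
have [ltij|gtij|/val_inj eij] := ltngtP i j.
- by exists (i, j); rewrite //= ltij.
- exists (j, i); rewrite /= ?gtij 1?setUC //.
  by apply: contraNneq nij => ->; rewrite erevK.
- by rewrite eij eqxx in ij.
Qed.

Variables (v : vertex G) (wxi : walk v xi) (T : {set {set 'I_n}}).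
Hypotheses (TLT : T \in TL n) (dT : delta_TL T).

(** The i-th vertex of the walk: edge [i] of the 0-based tuple runs from [vtx i] to [vtx i.+1]. *)
Let vtx (i : nat) : vertex G := last v (map (@etgt R G) (take i xi)).

Let esrc_vtx (i : 'I_n) : esrc (tnth xi i) = vtx i.
Proof.
rewrite (tnth_nth (tnth xi i)).
by case: (walk_nth (tnth xi i) wxi (i := i)); rewrite ?size_tuple.
Qed.

Let etgt_vtx (i : 'I_n) : etgt (tnth xi i) = vtx i.+1.
Proof.
rewrite (tnth_nth (tnth xi i)).
by case: (walk_nth (tnth xi i) wxi (i := i)); rewrite ?size_tuple.
Qed.

(* Past the partner j of the first edge, the rest of the interval is again
   T-stable. *)
Let vtx_interval (a b : nat) : (a <= b <= n)%N ->
    (forall i j : 'I_n, i != j -> [set i; j] \in T ->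
       (a <= i < b)%N -> (a <= j < b)%N) ->
  vtx a = vtx b.
Proof.
have [m] := ubnP (b - a); elim: m a => // m IHm a bam /andP[ab bn] stab.
have [eab|ltab] : a = b \/ (a < b)%N by lia.
  by rewrite eab.
have an : (a < n)%N by lia.
pose i := Ordinal an; have [j ji ijT] := TL_partner TLT i.
have aj : (a <= j < b)%N by apply: (stab i) => //=; [rewrite eq_sym | lia].
have -> : vtx a = vtx j.+1.
  rewrite -(esrc_vtx i) -etgt_vtx (delta_TLP _ dT i j) ?esrc_rev //.
  by rewrite eq_sym.
(* A chord from [h] past [j] cannot end at [i] or [j], whose partners are each other, nor strictly
   between them, where it would cross the chord of [i] and [j]. *)
apply: IHm => [||h h' hh' hT hin]; [lia | lia |].
have h'in : (a <= h' < b)%N by apply: (stab h) => //; lia.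
have h'a : h' != i.
  apply: contraTneq hin => h'i; move: hT; rewrite h'i setUC => hT.
  by rewrite -(TL_partner_uniq TLT ji _ ijT hT) -?h'i // ltnn.
have h'j : h' != j.
  apply: contraTneq hin => h'j; move: hT; rewrite h'j setUC => hT.
  have jiT : [set j; i] \in T by rewrite setUC.
  have -> : h = i.
    apply: (TL_partner_uniq TLT _ _ hT jiT); rewrite // 1?eq_sym //.
    by rewrite -h'j eq_sym.
  by rewrite /=; clear -aj; lia.
have [h'ltj|jh'] := ltnP h' j.
  case: (TL_noncrossing TLT (a := i) (b := h') (c := j) (d := h)) => //.
  - by rewrite setUC.
  - by move: h'a; rewrite -val_eqE /=; clear -h'in h'ltj; lia.
  - by case/andP: hin.
by move: h'j; rewrite -val_eqE /=; clear -h'in jh'; lia.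
Qed.

(** The whole index range is T-stable. *)
Lemma delta_closed : last v (map (@etgt R G) xi) = v.
Proof.
have := @vtx_interval 0 n; rewrite /vtx take0 take_oversize ?size_tuple //=.
by move=> vtx0n; apply/esym/vtx0n => // i j _ _ _; rewrite ltn_ord.
Qed.

(** For c < d in one block, a chord of [T] with exactly one end among c + 1, ..., d would cross that
    block; so this interval is T-stable and the walk returns to its vertex. *)
Lemma kreweras_block_vertex K B c d :
  kreweras_admissible T K -> B \in K -> c \in B -> d \in B ->
  etgt (tnth xi c) = etgt (tnth xi d).
Proof.
pose F := img_family (@inl 'I_n 'I_n) T :|: img_family (@inr 'I_n 'I_n) K.
move=> /andP[_ ncTK] BK; have /noncrossingP ncF : noncrossing (@interleave n) F.
  exact: ncTK.
wlog ltcd : c d / (c < d)%N => [hwlog cB dB|cB dB].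
  by have [/hwlog->|/hwlog->|/val_inj->] := ltngtP c d.
rewrite !etgt_vtx; apply: vtx_interval => [|i j ij ijT iin].
  by rewrite ltnW /=.
have iT : inl @: [set i; j] \in F by rewrite inE imset_f.
have KT : inr @: B \in F by rewrite inE orbC imset_f.
have li : @inl 'I_n 'I_n i \in inl @: [set i; j] by rewrite imset_f ?set21.
have lj : @inl 'I_n 'I_n j \in inl @: [set i; j] by rewrite imset_f ?set22.
have rc : @inr 'I_n 'I_n c \in inr @: B by rewrite imset_f.
have rd : @inr 'I_n 'I_n d \in inr @: B by rewrite imset_f.
have disj : inl @: [set i; j] != inr @: B :> {set 'I_n + 'I_n}.
  by apply: contraTneq li => ->; apply/imsetP => -[].
(* A chord leaving on the left gives the crossing j < c' < i < d', and one leaving on the right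
   gives c' < i < d' < j. *)
have [jc|cj] := leqP j c.
  have jci : (j.*2 < c.*2.+1 < i.*2)%N by clear -jc iin; lia.
  have id : (i.*2 < d.*2.+1)%N by clear -iin; lia.
  by case/eqP: disj; apply: (ncF _ _ _ _ _ _ iT KT lj rc li rd jci id).
have [dj|jd] := ltnP d j.
  have cid : (c.*2.+1 < i.*2 < d.*2.+1)%N by clear -iin; lia.
  have d_j : (d.*2.+1 < j.*2)%N by clear -dj; lia.
  by case/eqP: disj; apply/esym/(ncF _ _ _ _ _ _ KT iT rc li rd lj cid d_j).
by apply/andP; split.
Qed.

End Delta.

(** * Rotation invariance of the weights and the trace property *)

Section Trace.
Variables (R : realType) (G : graph R).
Implicit Types (p q : gpath G) (s : seq (edge G)).

Section RotateTuple.
Variables (n k : nat) (kn : (k <= n)%N) (xi eta : n.-tuple (edge G)).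
Hypothesis etaE : forall i, tnth eta i = tnth xi (ord_rot k i).
Local Notation rotf := (img_family (@ord_rot n k)).

Lemma delta_TL_rot T : delta_TL xi (rotf T) = delta_TL eta T.
Proof.
have rK := ord_rotK kn; have rVK := ord_rotVK kn; have r_inj := can_inj rK.
have rT (i j : 'I_n) :
    ([set ord_rot k i; ord_rot k j] \in rotf T) = ([set i; j] \in T).
  have -> : [set ord_rot k i; ord_rot k j] = ord_rot k @: [set i; j].
    by rewrite imsetU !imset_set1.
  by rewrite mem_imset //; apply: imset_inj.
apply/delta_TLP/delta_TLP => dT i j ij ijT.
  by rewrite !etaE; apply: dT; rewrite ?rT ?(inj_eq r_inj).
rewrite -(rVK i) -(rVK j) -!etaE; apply: dT.
  by rewrite (can_eq rVK).
by rewrite -rT !rVK.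
Qed.

Lemma tau_TL_rot v T : walk v eta -> T \in TL n ->
  tau_TL xi (rotf T) = tau_TL eta T.
Proof.
move=> weta TLT; rewrite !tau_TLE delta_TL_rot.
have [dT|_] := boolP (delta_TL eta T); last by rewrite !mul0r.
have r_inj := can_inj (ord_rotK kn).
congr (_ * _); rewrite kreweras_rot // big_imset /=; last first.
  by move=> B D _ _; apply: imset_inj.
have [/andP[admK _]|[-> _]] := krewerasP T; last by rewrite !big_set0.
apply: eq_bigr => B BK; rewrite /tau_block card_imset //.
(* The point picked in the rotated block need not be the image of the point picked in [B], but both
   carry the same vertex. *)
case: pickP => [c /imsetP[c' c'B ->]|noc]; case: pickP => [d dB|nod] //.
- by rewrite -etaE (kreweras_block_vertex weta TLT dT admK BK c'B dB).
- by have := nod c'; rewrite /= c'B.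
- by have := noc (ord_rot k d); rewrite /= imset_f.
Qed.

End RotateTuple.

(** For positive length the weight depends on the edges alone, which makes it possible to rotate
    them without tracking the start vertex. *)
Definition tau_seq s : R := \sum_(T in TL (size s)) tau_TL (in_tuple s) T.

(** Transports the sum along [size t = n], so that a sequence and its rotation are summed over the
    same [TL n]. *)
Lemma tau_seq_tuple n (t : n.-tuple (edge G)) :
  tau_seq t = \sum_(T in TL n) tau_TL t T.
Proof.
case: t => s sn; have e : size s = n by apply/eqP.
move: sn; case: n / e => ss; rewrite (_ : Tuple ss = in_tuple s).
  by rewrite /tau_seq.
exact: val_inj.
Qed.

Lemma tnth_rot n k (t : n.-tuple (edge G)) (i : 'I_n) : (k <= n)%N ->
  tnth [tuple of rot k t] i = tnth t (ord_rot k i).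
Proof.
move=> kn; have e0 := tnth t i; rewrite !(tnth_nth e0) /=.
rewrite /rot nth_cat size_drop size_tuple.
have [lti|gei] := ltnP i (n - k).
  by rewrite nth_drop modn_small 1?addnC //; lia.
rewrite nth_take; last by have := ltn_ord i; lia.
congr (nth _ _ _); have -> : (i + k = (i - (n - k)) + n)%N by lia.
by rewrite modnDr modn_small //; have := ltn_ord i; lia.
Qed.

(** Rotation permutes [TL (size s)], so the sum is reindexed and compared term by term. *)
Lemma tau_seq_rot v k s : (k <= size s)%N -> walk v (rot k s) ->
  tau_seq (rot k s) = tau_seq s.
Proof.
move=> ks ws; rewrite (tau_seq_tuple [tuple of rot k (in_tuple s)]).
have rTK := img_familyK (ord_rotK ks).
rewrite /tau_seq [RHS](reindex_inj (can_inj rTK)).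
have rTL T : (img_family (@ord_rot _ k) T \in TL (size s)) = (T \in TL (size s)).
  apply/idP/idP => [/(TL_rot (leq_subr k (size s)))|/(TL_rot ks)//].
  by rewrite rTK.
rewrite [RHS](eq_bigl _ _ rTL); apply: eq_bigr => T TLT.
apply/esym/(tau_TL_rot (eta := [tuple of rot k (in_tuple s)]) ks _ ws TLT) => i.
exact: tnth_rot.
Qed.

Lemma tau_path_open p : pend p != pstart p -> tau_path p = 0.
Proof.
case: p => [[v s] ws] /=; rewrite /pend /pstart /tau_path /plength /pedges /=.
move=> open; case: ifP => [/eqP/size0nil s0|_].
  by rewrite s0 eqxx in open.
apply: big1 => T TLT; rewrite tau_TLE.
have [dT|_] := boolP (delta_TL _ T); last by rewrite mul0r.
by rewrite (delta_closed (xi := in_tuple s) ws TLT dT) eqxx in open.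
Qed.

Lemma tau_pathE p : tau_path p =
  if pedges p is [::] then mu (pstart p) ^+ 2 else tau_seq (pedges p).
Proof.
by rewrite /tau_path /plength -/(tau_seq (pedges p)); case: (pedges p).
Qed.

Lemma tau_path_catC p q (hpq : pend p = pstart q) (hqp : pend q = pstart p) :
  tau_path (path_cat hpq) = tau_path (path_cat hqp).
Proof.
have wqp : walk (pstart q) (pedges q ++ pedges p) :=
  gpath_walk (path_cat hqp).
have tau_cat : tau_seq (pedges p ++ pedges q) = tau_seq (pedges q ++ pedges p).
  rewrite -rot_size_cat in wqp *; rewrite (tau_seq_rot _ wqp) //.
  by rewrite size_cat leq_addr.
(* Needed when both paths have length zero, where the weight comes from the start vertex. *)
have pq0 : pedges p = [::] -> pstart p = pstart q.
  by move=> p0; rewrite -hpq /pend p0.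
rewrite !tau_pathE /pedges /= -/(pedges p) -/(pedges q).
move: pq0 tau_cat; rewrite /pstart /= -/(pstart p) -/(pstart q).
case: (pedges p) => [/(_ erefl) <-|e s _]; first by rewrite cats0.
by case: (pedges q) => [|e' s'] /=; rewrite ?cats0.
Qed.

Local Notation C := R[i].

Implicit Types (x y : {malg C[gpath G]}).

(** With [C^o], the field as a module over itself, scaling is multiplication and [tau] is a
    [malg_lift] by conversion. *)
Definition tau_basis p : C^o := (tau_path p)%:C%C.

Lemma tauE x : tau x = malg_lift idfun tau_basis x.
Proof. by []. Qed.

(** If only one of the two products is composable, it is an open path, whose weight vanishes like
    the zero product. *)
Lemma tau_basis_mulC p q :
  malg_lift idfun tau_basis (path_mul p q) =
  malg_lift idfun tau_basis (path_mul q p).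
Proof.
have [hpq|npq] := eqVneq (pend p) (pstart q);
  have [hqp|nqp] := eqVneq (pend q) (pstart p).
- rewrite (path_mul_cat hpq) (path_mul_cat hqp) !malg_liftU.
  by rewrite /tau_basis (tau_path_catC hpq hqp).
- rewrite (path_mul_cat hpq) (path_mul_neq nqp) malg_liftU malg_lift0.
  by rewrite /tau_basis tau_path_open ?pend_cat.
- rewrite (path_mul_cat hqp) (path_mul_neq npq) malg_liftU malg_lift0.
  by rewrite /tau_basis tau_path_open ?pend_cat.
- by rewrite (path_mul_neq npq) (path_mul_neq nqp).
Qed.

Lemma tau_mulC x y : tau (gr_mul x y) = tau (gr_mul y x).
Proof. exact: (malg_lift_mulC tau_basis_mulC x y). Qed.

Lemma tau_normalised_trace :
  is_normalised_trace (gr_one G) (@gr_mul R G) (@tau R G).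
Proof.
split; last exact: tau_mulC.
  by move=> a x y; exact: (malg_liftP idfun tau_basis a x y).
rewrite tauE malg_lift_sum (eq_bigr (fun v => (mu v ^+ 2)%:C%C)) => [|v _].
  by rewrite -rmorph_sum mu_sum1 rmorph1.
exact: malg_liftU.
Qed.

End Trace.

Theorem proposition1 (R : realType) (G : graph R) :
  is_graded_star_algebra (@gr_grade R G) (gr_one G) (@gr_mul R G) (@gr_star R G)
  /\ is_normalised_trace (gr_one G) (@gr_mul R G) (@tau R G).
Proof.
split; [exact: gr_graded_star_algebra | exact: tau_normalised_trace].
Qed.
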